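(* Let $0<\varepsilon<1$ and $C\ge1$. Let $V_1,\dots,V_5$ be probability spaces, with indices taken mod $5$. For each $i$, let $f_{i,i+1},g_{i,i+1}\colon V_i\times V_{i+1}\to[0,\infty)$ be measurable with $0\le g_{i,i+1}\le1$ pointwise and $\|f_{i,i+1}-g_{i,i+1}\|_\square\le\varepsilon^4$, and suppose that for each $i$, $$\|f_{i-1,i}\circ f_{i,i+1}\|_2^2\le C.$$ Then $$\mathbb E_{x_1,\dots,x_5}\prod_{i=1}^5 f_{i,i+1}(x_i,x_{i+1})\ \ge\ \mathbb E_{x_1,\dots,x_5}\prod_{i=1}^5 g_{i,i+1}(x_i,x_{i+1})-11C\varepsilon.$$
   Context: Here $x_i$ ranges over $V_i$ independently according to its probability measure. The convention $f_{ji}(x_j,x_i)=f_{ij}(x_i,x_j)$ (and likewise for $g$) is used, so e.g. $f_{i-1,i}$ is regarded as a function on $V_{i-1}\times V_i$. For $h_{12}\colon V_1\times V_2\to\mathbb R$ and $h_{23}\colon V_2\times V_3\to\mathbb R$, the composition $h_{12}\circ h_{23}\colon V_1\times V_3\to\mathbb R$ is $(h_{12}\circ h_{23})(x_1,x_3)=\mathbb E_{x_2\in V_2}h_{12}(x_1,x_2)h_{23}(x_2,x_3)$; $\|\cdot\|_2$ is the $L^2$ norm on $V_{i-1}\times V_{i+1}$ with the product probability measure. The cut norm of $h\colon V\times W\to\mathbb R$ is $\|h\|_\square=\sup_{A\subseteq V,B\subseteq W}|\mathbb E_{x\in V,y\in W}h(x,y)1_A(x)1_B(y)|$ over measurable $A,B$.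 *)

(* Defs.v *)
From HB Require Import structures.
From mathcomp Require Import all_boot all_order all_algebra.
From mathcomp Require Import all_classical all_reals all_analysis.
Set Implicit Arguments. Unset Strict Implicit. Unset Printing Implicit Defensive.
Import Order.TTheory GRing.Theory Num.Theory.
Local Open Scope classical_set_scope.
Local Open Scope ring_scope.
Local Open Scope ereal_scope.

Definition cutnorm d1 d2 (V : measurableType d1) (W : measurableType d2)
  (R : realType) (P : probability V R) (Q : probability W R) (h : V -> W -> R)
  : \bar R :=
  ereal_sup [set r | exists A : set V, exists B : set W,
    [/\ measurable A, measurable B &
        r = `| \int[P \x Q]_p ((h p.1 p.2 * \1_A p.1 * \1_B p.2)%R)%:E |]].

Definition compo d1 d2 d3 (V1 : measurableType d1) (V2 : measurableType d2)
  (V3 : measurableType d3) (R : realType) (P2 : probability V2 R)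
  (h12 : V1 -> V2 -> R) (h23 : V2 -> V3 -> R) : V1 -> V3 -> \bar R :=
  fun x1 x3 => \int[P2]_x2 ((h12 x1 x2 * h23 x2 x3)%R)%:E.

Definition L2sq d1 d2 (V : measurableType d1) (W : measurableType d2)
  (R : realType) (P : probability V R) (Q : probability W R)
  (k : V -> W -> \bar R) : \bar R :=
  \int[P \x Q]_p (k p.1 p.2 * k p.1 p.2).

(* E_{x1,...,x5} of a nonnegative function, as an iterated integral
   (equal to the integral over the product measure by Tonelli) *)
Definition E5 d1 d2 d3 d4 d5 (V1 : measurableType d1) (V2 : measurableType d2)
  (V3 : measurableType d3) (V4 : measurableType d4) (V5 : measurableType d5)
  (R : realType) (P1 : probability V1 R) (P2 : probability V2 R)
  (P3 : probability V3 R) (P4 : probability V4 R) (P5 : probability V5 R)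
  (F : V1 -> V2 -> V3 -> V4 -> V5 -> R) : \bar R :=
  \int[P1]_x1 \int[P2]_x2 \int[P3]_x3 \int[P4]_x4 \int[P5]_x5
     (F x1 x2 x3 x4 x5)%:E.

(* Main.v *)
Require Import Defs.
From HB Require Import structures.
From mathcomp Require Import all_boot all_order all_algebra.
From mathcomp Require Import all_classical all_reals all_analysis.
From mathcomp Require Import measurable_realfun ring lra.
Import Order.TTheory GRing.Theory Num.Theory.
Local Open Scope classical_set_scope.
Local Open Scope ring_scope.

(** Write [u = f12 o f23] and [w = f45 o f51]; the 5-cycle density is then the
    triangle density of [u], [f34], [w].  Only lower bounds are needed, so [u]
    and [w] may be truncated, at heights [K = eps^-2] and [L = eps^-1].  As
    [g12, g23 <= 1], testing [g12 o g23] against a rectangle exceeds testing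
    [u] by at most [2 eps^4] (cap the degree functions at 1), and truncating
    [u] loses at most [C / K] in L1 norm; likewise for [w].  Replacing in turn
    [f34], [u], [w] by their [g] counterparts costs [K L eps^4],
    [L (2 eps^4 + C / K)] and [2 eps^4 + C / L], at most [7 C eps] in all. *)

(** The obstacle is unboundedness: an edge of a triangle can be exchanged under cut closeness only
    if the other two edges, which act as test weights, are bounded. A single [f] has no controlled
    tail, but a composition has a second moment, so the truncation is made on the compositions.
    Unequal heights are essential. Exchanging [f34] uses both heights; [u] comes next, against [w]
    at height [L] and an edge already bounded by 1; [w] comes last, against two edges bounded by 1.
    For all three errors to be of order [C eps], the term [C / L] asks for [L] of order at least
    [eps^-1], the term [L C / K] then asks for [K] of order at least [eps^-2], and [K L eps^4]
    permits [K L] of order at most [eps^-3]: the three demands just meet, thanks to the exponent 4.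
    Equal heights would leave an error [C] in the middle exchange. *)

Lemma measurable_uncurried {d d1 d2 d3} {T : measurableType d}
    {V : measurableType d1} {W : measurableType d2} {U : measurableType d3}
    {f : V -> W -> U} (a : T -> V) (b : T -> W) :
  measurable_fun setT (fun p : V * W => f p.1 p.2) ->
  measurable_fun setT a -> measurable_fun setT b ->
  measurable_fun setT (fun t => f (a t) (b t)).
Proof.
by move=> mf ma mb; exact: (measurableT_comp mf (measurable_fun_pair ma mb)).
Qed.

(** Kernels are curried but their measurability is stated on pairs, so each slice, flip or
    reindexing [f (a t) (b t)] is reduced to the two coordinate maps, found by second-order
    matching. *)
Ltac measurability :=
  repeat first
  [ exact: measurable_id | exact: measurable_cst
  | exact: measurable_fst | exact: measurable_snd
  | assumption
  | match goal with
    | H : measurable_fun _ (fun p => ?f p.1 p.2) |-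
        measurable_fun _ (fun t => ?f (@?a t) (@?b t)) =>
      apply: (measurable_uncurried a b H)
    | H : measurable_fun _ (fun p => ?f p.1 p.2) |- measurable_fun _ (?f ?x) =>
      refine (measurable_uncurried (fun=> x) id H _ _)
    | H : measurable_fun _ ?a |- measurable_fun _ (fun t => ?a (@?u t)) =>
      refine (@measurableT_comp _ _ _ _ _ _ a _ u H _)
    | |- measurable_fun _ (fun t => (@?u t).1) =>
      refine (@measurableT_comp _ _ _ _ _ _ fst _ u measurable_fst _)
    | |- measurable_fun _ (fun t => (@?u t).2) =>
      refine (@measurableT_comp _ _ _ _ _ _ snd _ u measurable_snd _)
    | |- measurable_fun _ (fun t => (@?x t * @?y t)%E) =>
      apply: (@emeasurable_funM _ _ _ _ x y)
    | |- measurable_fun _ (fun t => GRing.add (@?x t) (@?y t)) =>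
      apply: (@emeasurable_funD _ _ _ _ x y)
    | |- measurable_fun _ (fun t => Order.min (@?x t) (@?y t)) =>
      apply: (@measurable_mine _ _ _ _ x y)
    end ].

Ltac nonneg :=
  repeat (intros; cbv beta; first [ solve [auto] | match goal with
      | |- is_true (@Order.le _ _ _ (mule _ _)) => apply: mule_ge0
      | |- is_true (@Order.le _ _ _ (GRing.add _ _)) => apply: adde_ge0
      | |- is_true (@Order.le _ _ _ (integral _ _ _)) =>
          apply: integral_ge0 => ? _
      end
    | match goal with H : forall x, is_true (_ <= _ <= _)%E |- _ =>
        exact: (proj1 (andP (H _))) end
    | match goal with H : forall x y, is_true (_ <= _ <= _)%E |- _ =>
        exact: (proj1 (andP (H _ _))) end ]).

Section cycle_counting.
Local Open Scope ereal_scope.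
Context {R : realType}.

(** * Tonelli for nonnegative extended-real kernels on probability spaces *)

Lemma measurable_integral {d1 d2} {V : measurableType d1}
    {W : measurableType d2} {Q : probability W R} {F : V -> W -> \bar R} :
  measurable_fun setT (fun p : V * W => F p.1 p.2) ->
  (forall x y, 0 <= F x y) -> measurable_fun setT (fun x => \int[Q]_y F x y).
Proof.
by move=> mF F0; apply: (measurable_fun_fubini_tonelli_F (m2 := Q) _ mF).
Qed.

Lemma measurable_marginal {d1 d2} {V : measurableType d1}
    {W : measurableType d2} (Q : probability W R) (f : V -> W -> \bar R)
    (b : W -> \bar R) :
  measurable_fun setT (fun p : V * W => f p.1 p.2) -> measurable_fun setT b ->
  (forall x y, 0 <= f x y) -> (forall y, 0 <= b y) ->
  measurable_fun setT (fun x => \int[Q]_y (f x y * b y)).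
Proof.
move=> mf mb f0 b0.
apply: (measurable_integral (F := fun x y => f x y * b y)); last by nonneg.
by measurability.
Qed.

Lemma integral_swap {d1 d2} {V : measurableType d1}
    {W : measurableType d2} (P : probability V R) (Q : probability W R)
    (F : V -> W -> \bar R) :
  measurable_fun setT (fun p : V * W => F p.1 p.2) ->
  (forall x y, 0 <= F x y) ->
  \int[P]_x \int[Q]_y F x y = \int[Q]_y \int[P]_x F x y.
Proof.
by move=> mF F0; apply: (fubini_tonelli (fun p => F p.1 p.2)).
Qed.

Lemma integral_prod {d1 d2} {V : measurableType d1}
    {W : measurableType d2} (P : probability V R) (Q : probability W R)
    (F : V -> W -> \bar R) :
  measurable_fun setT (fun p : V * W => F p.1 p.2) ->
  (forall x y, 0 <= F x y) ->
  \int[P \x Q]_p F p.1 p.2 = \int[P]_x \int[Q]_y F x y.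
Proof.
by move=> mF F0; rewrite (fubini_tonelli1 (fun p => F p.1 p.2)).
Qed.

Lemma integral_probability_cst {d} {V : measurableType d}
  (P : probability V R) (c : \bar R) : \int[P]_x c = c.
Proof.
rewrite (integral_cst P measurableT c).
by rewrite -[X in _ * X]/(P setT) (@probability_setT _ _ _ P) mule1.
Qed.

Lemma le_integralT {d} {V : measurableType d} (P : probability V R)
    (f g : V -> \bar R) :
  (forall x, 0 <= f x) -> (forall x, f x <= g x) ->
  measurable_fun setT f -> measurable_fun setT g ->
  \int[P]_x f x <= \int[P]_x g x.
Proof.
move=> f0 fg mf mg; apply: ge0_le_integral => //.
Qed.

(** * The excess [maxe (G - F) 0] as a one-sided distance *)

(** The worst test set is the one where [F < G]: on it the tested difference is exactly the positive
    part of [G - F]. *)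
Lemma integral_excess_le {d} {V : measurableType d} (P : probability V R)
    (F G : V -> \bar R) (delta : R) :
  measurable_fun setT F -> measurable_fun setT G ->
  (forall x, 0 <= F x) -> (forall x, 0 <= G x <= 1) ->
  (forall A, measurable A -> \int[P]_x (G x * (\1_A x)%:E) <=
     \int[P]_x (F x * (\1_A x)%:E) + delta%:E) ->
  \int[P]_x maxe (G x - F x) 0 <= delta%:E.
Proof.
move=> mF mG F0 G01 H.
pose A := [set x | F x < G x].
have mA : measurable A.
  by rewrite -[A]setTI; apply: measurable_lte.
have mI : measurable_fun setT (fun x => (\1_A x)%:E : \bar R).
  by apply/measurable_EFinP; exact: measurable_indic.
(* [F] may have infinite integral, but on [A] it lies below [G <= 1]. Its integral over [A] is
   therefore finite and can be cancelled from both sides. *)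
have F1 : \int[P]_x (F x * (\1_A x)%:E) <= 1.
  rewrite -[leRHS](integral_probability_cst P 1); apply: le_integralT => //.
  - by move=> x; rewrite mule_ge0// lee_fin.
  - move=> x; rewrite indicE; case: (boolP (x \in A)) => [|_]; last by rewrite mule0.
    rewrite inE /A/= mule1 => /ltW /le_trans; apply.
    by have /andP[] := G01 x.
  - exact: emeasurable_funM.
have F0' : 0 <= \int[P]_x (F x * (\1_A x)%:E).
  by apply: integral_ge0 => x _; rewrite mule_ge0// lee_fin.
have Ffin : \int[P]_x (F x * (\1_A x)%:E) \is a fin_num.
  by rewrite ge0_fin_numE//; apply: (le_lt_trans F1); exact: ltry.
have := H A mA.
rewrite (_ : \int[P]_x (G x * _) =
  \int[P]_x maxe (G x - F x) 0 + \int[P]_x (F x * (\1_A x)%:E)).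
  by rewrite addeC leeD2lE.
rewrite -ge0_integralD//=.
- apply: eq_integral => x _; rewrite indicE.
  have /andP[G0 G1] := G01 x.
  have Gf : G x \is a fin_num.
    by rewrite ge0_fin_numE//; apply: (le_lt_trans G1); exact: ltry.
  case: (boolP (x \in A)) => [|].
    rewrite inE /A/= => FG; rewrite !mule1.
    have Ff : F x \is a fin_num.
      by rewrite ge0_fin_numE//; apply: (lt_le_trans FG); exact: leey.
    by rewrite max_l ?subeK// sube_ge0 ?ltW// Ff.
  rewrite notin_setE /A/= => /negP; rewrite -leNgt => GF.
  by rewrite !mule0 adde0 max_r// sube_le0.
- by move=> x _; rewrite le_max lexx orbT.
- by apply: measurable_maxe => //; exact: emeasurable_funB.
- by move=> x _; rewrite mule_ge0// lee_fin.
- exact: emeasurable_funM.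
Qed.

(** For [b = +oo] the excess is 0 whatever [a] is, and the bound survives because the right side is
    already infinite. *)
Lemma le_add_excess (a b : \bar R) : 0 <= b -> a <= b + maxe (a - b) 0.
Proof.
case: b => [b _|_|//]; last first.
  by rewrite addye ?leey// gt_eqF// (lt_le_trans (ltNyr 0%R))// le_max lexx orbT.
by rewrite addeC -leeBlDr// le_max lexx.
Qed.

(* One-sided closeness: unlike the cut norm, it survives composition and
   truncation of an unbounded [f], and involves no integral of a difference. *)
Definition cut_le {d1 d2} {V : measurableType d1} {W : measurableType d2}
    (P : probability V R) (Q : probability W R) (g f : V -> W -> \bar R)
    (delta : R) :=
  forall (a : V -> \bar R) (b : W -> \bar R),
  measurable_fun setT a -> measurable_fun setT b ->
  (forall x, 0 <= a x <= 1) -> (forall y, 0 <= b y <= 1) ->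
  \int[P]_x \int[Q]_y (g x y * (a x * b y)) <=
  \int[P]_x \int[Q]_y (f x y * (a x * b y)) + delta%:E.

(** As [a <= 1], pointwise [G a <= F a + maxe (G - F) 0], so one bound on the excess serves all
    weights at once. Combined with [integral_excess_le], this passes from indicator tests to weights
    in [0,1], in place of a layer-cake decomposition. *)
Lemma weighted_le_of_excess {d} {V : measurableType d} (P : probability V R)
    (F G a : V -> \bar R) (delta : R) :
  measurable_fun setT F -> measurable_fun setT G -> measurable_fun setT a ->
  (forall x, 0 <= F x) -> (forall x, 0 <= G x) -> (forall x, 0 <= a x <= 1) ->
  \int[P]_x maxe (G x - F x) 0 <= delta%:E ->
  \int[P]_x (G x * a x) <= \int[P]_x (F x * a x) + delta%:E.
Proof.
move=> mF mG ma F0 G0 a01 H.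
have a0 x : 0 <= a x by have /andP[] := a01 x.
have mM : measurable_fun setT (fun x => maxe (G x - F x) 0).
  by apply: measurable_maxe => //; exact: emeasurable_funB.
apply: le_trans (leeD2l _ H).
rewrite -ge0_integralD//=.
- apply: le_integralT => //.
  + by move=> x; rewrite mule_ge0.
  + move=> x; apply: (@le_trans _ _ ((F x + maxe (G x - F x) 0) * a x)).
      by rewrite lee_wpmul2r// le_add_excess.
    rewrite ge0_muleDl// ?le_max ?lexx ?orbT//.
    rewrite leeD2l// -[leRHS]mule1 lee_wpmul2l// ?le_max ?lexx ?orbT//.
    by have /andP[] := a01 x.
  + exact: emeasurable_funM.
  + by apply: emeasurable_funD => //; exact: emeasurable_funM.
- by move=> x _; rewrite mule_ge0.
- exact: emeasurable_funM.
- by move=> x _; rewrite le_max lexx orbT.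
Qed.

(** * From rectangle tests to weights with values in [0,1] *)

Lemma weighted_integralZl {d1 d2} {V : measurableType d1}
    {W : measurableType d2} (P : probability V R) (Q : probability W R)
    (f : V -> W -> \bar R) (a : V -> \bar R) (b : W -> \bar R) :
  measurable_fun setT (fun p : V * W => f p.1 p.2) ->
  measurable_fun setT b -> (forall x y, 0 <= f x y) ->
  (forall x, 0 <= a x) -> (forall y, 0 <= b y) ->
  \int[P]_x \int[Q]_y (f x y * (a x * b y)) =
  \int[P]_x ((\int[Q]_y (f x y * b y)) * a x).
Proof.
move=> mf mb f0 a0 b0; apply: eq_integral => x _.
rewrite muleC -ge0_integralZl//=.
- by apply: eq_integral => y _; rewrite muleCA.
- apply: emeasurable_funM => //.
  exact: (measurable_uncurried (fun=> x) id mf).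
- by move=> y _; rewrite mule_ge0.
Qed.

(** With [b] fixed, integrating out [y] leaves two functions of [x] alone; [g <= 1] and [b <= 1] on
    a space of mass 1 keep the one coming from [g] below 1, as [integral_excess_le] demands. *)
Lemma excess_le_of_indicators {d1 d2} {V : measurableType d1}
    {W : measurableType d2} (P : probability V R) (Q : probability W R)
    (g f : V -> W -> \bar R) (b : W -> \bar R) (delta : R) :
  measurable_fun setT (fun p : V * W => f p.1 p.2) ->
  measurable_fun setT (fun p : V * W => g p.1 p.2) ->
  (forall x y, 0 <= f x y) -> (forall x y, 0 <= g x y <= 1) ->
  measurable_fun setT b -> (forall y, 0 <= b y <= 1) ->
  (forall A, measurable A ->
    \int[P]_x \int[Q]_y (g x y * ((\1_A x)%:E * b y)) <=
    \int[P]_x \int[Q]_y (f x y * ((\1_A x)%:E * b y)) + delta%:E) ->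
  \int[P]_x maxe (\int[Q]_y (g x y * b y) - \int[Q]_y (f x y * b y)) 0
    <= delta%:E.
Proof.
move=> mf mg f0 g01 mb b01 H.
have g0 x y : 0 <= g x y by have /andP[] := g01 x y.
have b0 y : 0 <= b y by have /andP[] := b01 y.
apply: integral_excess_le => //.
- exact: measurable_marginal.
- exact: measurable_marginal.
- by move=> x; apply: integral_ge0 => y _; rewrite mule_ge0.
- move=> x; apply/andP; split.
    by apply: integral_ge0 => y _; rewrite mule_ge0.
  rewrite -[leRHS](integral_probability_cst Q 1); apply: le_integralT => //.
  + by move=> y; rewrite mule_ge0.
  + move=> y; rewrite -[leRHS]mule1 lee_pmul//.
      by have /andP[] := g01 x y.
    by have /andP[] := b01 y.
  + apply: emeasurable_funM => //.
    exact: (measurable_uncurried (fun=> x) id mg).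
- move=> A mA; rewrite -!weighted_integralZl//; exact: H.
Qed.

Lemma weighted_le_of_indicators {d1 d2} {V : measurableType d1}
    {W : measurableType d2} (P : probability V R) (Q : probability W R)
    (g f : V -> W -> \bar R) (b : W -> \bar R) (delta : R) :
  measurable_fun setT (fun p : V * W => f p.1 p.2) ->
  measurable_fun setT (fun p : V * W => g p.1 p.2) ->
  (forall x y, 0 <= f x y) -> (forall x y, 0 <= g x y <= 1) ->
  measurable_fun setT b -> (forall y, 0 <= b y <= 1) ->
  (forall A, measurable A ->
    \int[P]_x \int[Q]_y (g x y * ((\1_A x)%:E * b y)) <=
    \int[P]_x \int[Q]_y (f x y * ((\1_A x)%:E * b y)) + delta%:E) ->
  forall a : V -> \bar R, measurable_fun setT a -> (forall x, 0 <= a x <= 1) ->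
  \int[P]_x \int[Q]_y (g x y * (a x * b y)) <=
  \int[P]_x \int[Q]_y (f x y * (a x * b y)) + delta%:E.
Proof.
move=> mf mg f0 g01 mb b01 H a ma a01.
have g0 x y : 0 <= g x y by have /andP[] := g01 x y.
have b0 y : 0 <= b y by have /andP[] := b01 y.
have a0 x : 0 <= a x by have /andP[] := a01 x.
rewrite !weighted_integralZl//; apply: weighted_le_of_excess => //.
- exact: measurable_marginal.
- exact: measurable_marginal.
- by move=> x; apply: integral_ge0 => y _; rewrite mule_ge0.
- by move=> x; apply: integral_ge0 => y _; rewrite mule_ge0.
- exact: excess_le_of_indicators.
Qed.

Lemma measurable_weighted {d1 d2} {V : measurableType d1}
    {W : measurableType d2} (f : V -> W -> \bar R) (a : V -> \bar R)
    (b : W -> \bar R) :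
  measurable_fun setT (fun p : V * W => f p.1 p.2) ->
  measurable_fun setT a -> measurable_fun setT b ->
  measurable_fun setT (fun p : V * W => f p.1 p.2 * (a p.1 * b p.2)).
Proof.
move=> mf ma mb; apply: emeasurable_funM => //; apply: emeasurable_funM.
- exact: (measurableT_comp ma).
- exact: (measurableT_comp mb).
Qed.

Lemma weighted_swap {d1 d2} {V : measurableType d1}
    {W : measurableType d2} (P : probability V R) (Q : probability W R)
    (f : V -> W -> \bar R) (a : V -> \bar R) (b : W -> \bar R) :
  measurable_fun setT (fun p : V * W => f p.1 p.2) ->
  measurable_fun setT a -> measurable_fun setT b ->
  (forall x y, 0 <= f x y) -> (forall x, 0 <= a x) -> (forall y, 0 <= b y) ->
  \int[P]_x \int[Q]_y (f x y * (a x * b y)) =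
  \int[Q]_y \int[P]_x (f x y * (b y * a x)).
Proof.
move=> mf ma mb f0 a0 b0; rewrite integral_swap.
- apply: eq_integral => y _; apply: eq_integral => x _.
  by rewrite [b y * _]muleC.
- exact: measurable_weighted.
- by move=> x y; rewrite !mule_ge0.
Qed.

Lemma indicator_01 {d} {V : measurableType d} (A : set V) x :
  0 <= (\1_A x : R)%:E <= 1.
Proof. by rewrite !lee_fin indicE ler0n lern1 leq_b1. Qed.

Lemma cut_le_of_indicators {d1 d2} {V : measurableType d1}
    {W : measurableType d2} (P : probability V R) (Q : probability W R)
    (g f : V -> W -> \bar R) (delta : R) :
  measurable_fun setT (fun p : V * W => f p.1 p.2) ->
  measurable_fun setT (fun p : V * W => g p.1 p.2) ->
  (forall x y, 0 <= f x y) -> (forall x y, 0 <= g x y <= 1) ->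
  (forall A B, measurable A -> measurable B ->
    \int[P]_x \int[Q]_y (g x y * ((\1_A x)%:E * (\1_B y)%:E)) <=
    \int[P]_x \int[Q]_y (f x y * ((\1_A x)%:E * (\1_B y)%:E)) + delta%:E) ->
  cut_le P Q g f delta.
Proof.
move=> mf mg f0 g01 H a b ma mb a01 b01.
have g0 x y : 0 <= g x y by have /andP[] := g01 x y.
have b0 y : 0 <= b y by have /andP[] := b01 y.
have a0 x : 0 <= a x by have /andP[] := a01 x.
have mI d (T : measurableType d) (A : set T) : measurable A ->
    measurable_fun setT (fun x => (\1_A x)%:E : \bar R).
  by move=> mA; apply/measurable_EFinP; exact: measurable_indic.
(* The weights are relaxed one variable at a time. With [y] outermost, [b] is reduced to an
   indicator while [a] stays arbitrary; after swapping back, [a] is reduced against that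
   indicator. *)
rewrite !(weighted_swap P Q)//.
apply: (weighted_le_of_indicators Q P (fun y x => g x y)
  (fun y x => f x y)) => //.
- exact: (measurable_uncurried snd fst mf).
- exact: (measurable_uncurried snd fst mg).
move=> B mB.
have B0 y : 0 <= (\1_B y : R)%:E by have /andP[] := indicator_01 B y.
have mB1 := mI _ _ B mB.
rewrite -(weighted_swap P Q g)// -(weighted_swap P Q f)//.
apply: weighted_le_of_indicators => //.
- exact: indicator_01.
- by move=> A mA; exact: H.
Qed.

Lemma cutnorm_cut_le {d1 d2} {V : measurableType d1}
    {W : measurableType d2} (P : probability V R) (Q : probability W R)
    (f g : V -> W -> R) (delta : R) :
  measurable_fun setT (fun p : V * W => f p.1 p.2) ->
  measurable_fun setT (fun p : V * W => g p.1 p.2) ->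
  (forall x y, (0 <= f x y)%R) -> (forall x y, (0 <= g x y <= 1)%R) ->
  cutnorm P Q (fun x y => (f x y - g x y)%R) <= delta%:E ->
  cut_le P Q (fun x y => (g x y)%:E) (fun x y => (f x y)%:E) delta.
Proof.
move=> mf mg f0 g01 fg.
apply: cut_le_of_indicators.
- exact/measurable_EFinP.
- exact/measurable_EFinP.
- by move=> x y; rewrite lee_fin.
- by move=> x y; rewrite !lee_fin.
move=> A B mA mB.
pose I (p : V * W) : R := (\1_A p.1 * \1_B p.2)%R.
have I01 p : (0 <= I p <= 1)%R.
  by rewrite /I !indicE mulr_ge0//= mulr_ile1// lern1 leq_b1.
have mI : measurable_fun setT I.
  apply: measurable_funM.
    by apply: (measurableT_comp (measurable_indic mA)).
  by apply: (measurableT_comp (measurable_indic mB)).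
have int_prod (h : V -> W -> R) : (forall x y, (0 <= h x y)%R) ->
    measurable_fun setT (fun p : V * W => h p.1 p.2) ->
    \int[P]_x \int[Q]_y ((h x y)%:E * ((\1_A x)%:E * (\1_B y)%:E)) =
    \int[P \x Q]_p ((h p.1 p.2 * I p)%R)%:E.
  move=> h0 mh; rewrite -(integral_prod P Q
      (fun x y => (h x y)%:E * ((\1_A x)%:E * (\1_B y)%:E)))//.
  - apply: (measurable_weighted (fun x y => (h x y)%:E)
      (fun x => (\1_A x)%:E) (fun y => (\1_B y)%:E));
      apply/measurable_EFinP => //; exact: measurable_indic.
  - by move=> x y; rewrite !mule_ge0// lee_fin.
have g0 x y : (0 <= g x y)%R by have /andP[] := g01 x y.
rewrite !int_prod//.
have mfI : measurable_fun setT (fun p : V * W => (f p.1 p.2 * I p)%R).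
  exact: measurable_funM.
have mgI : measurable_fun setT (fun p : V * W => (g p.1 p.2 * I p)%R).
  exact: measurable_funM.
have I0 p : (0 <= I p)%R by have /andP[] := I01 p.
(* The integral of [f - g] in [cutnorm] splits into a difference only when [f] is integrable on the
   rectangle. If it is not, the right side of the goal is infinite and the claim is trivial. *)
have [foo|foo] := ltP (\int[P \x Q]_p ((f p.1 p.2 * I p)%R)%:E) +oo; last first.
  by move: foo; rewrite leye_eq => /eqP ->; rewrite addye ?leey.
have fint : (P \x Q).-integrable setT (EFin \o fun p => (f p.1 p.2 * I p)%R).
  apply/integrableP; split; first exact/measurable_EFinP.
  under eq_integral do rewrite /= ger0_norm ?mulr_ge0//.
  exact: foo.
have gint : (P \x Q).-integrable setT (EFin \o fun p => (g p.1 p.2 * I p)%R).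
  apply: (@le_integrable _ _ _ _ _ measurableT _ (EFin \o cst 1%R)); last 1 first.
  - apply/integrableP; split; first exact/measurable_EFinP.
    under eq_integral do rewrite /= normr1.
    by rewrite (integral_prod P Q (fun _ _ => 1))// !integral_probability_cst ltry.
  - exact/measurable_EFinP.
  - move=> p _ /=; rewrite lee_fin ger0_norm ?mulr_ge0// normr1.
    have /andP[g0' g1] := g01 p.1 p.2; have /andP[i0 i1] := I01 p.
    by rewrite mulr_ile1.
have : `|\int[P \x Q]_p (((f p.1 p.2 - g p.1 p.2) * \1_A p.1 * \1_B p.2)%R)%:E|
    <= delta%:E.
  by apply: le_trans fg; apply: ereal_sup_ubound; exists A, B.
have -> : \int[P \x Q]_p (((f p.1 p.2 - g p.1 p.2) * \1_A p.1 * \1_B p.2)%R)%:E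
   = \int[P \x Q]_p ((f p.1 p.2 * I p)%R)%:E - \int[P \x Q]_p ((g p.1 p.2 * I p)%R)%:E.
  rewrite -integralB_EFin//; apply: eq_integral => p _.
  by rewrite -EFinB -mulrA mulrBl.
have := integrable_fin_num measurableT fint.
have := integrable_fin_num measurableT gint.
rewrite /comp /=.
case: (\int[P \x Q]_p ((g p.1 p.2 * I p)%R)%:E) => // s _.
case: (\int[P \x Q]_p ((f p.1 p.2 * I p)%R)%:E) => // r _.
rewrite -EFinB abse_EFin -EFinD !lee_fin ler_norml => /andP[]; lra.
Qed.

(** * Compositions of kernels *)

(** Telescoping a product needs a bounded factor on the [F] side. Capping [F1] at 1 provides it for
    free: since [G1 <= 1], the excess of [G1] over the capped [F1'] is no larger than over [F1]. *)
Lemma mule_le_add_excess (G1 F1 G2 F2 : \bar R) :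
  0 <= F1 -> 0 <= F2 -> 0 <= G1 <= 1 -> 0 <= G2 <= 1 ->
  G1 * G2 <= F1 * F2 + (maxe (G1 - F1) 0 + maxe (G2 - F2) 0).
Proof.
move=> F10 F20 /andP[G10 G11] /andP[G20 G21].
set r1 := maxe _ _; set r2 := maxe _ _.
have r10 : 0 <= r1 by rewrite le_max lexx orbT.
have r20 : 0 <= r2 by rewrite le_max lexx orbT.
pose F1' := mine F1 1.
have F1'0 : 0 <= F1' by rewrite le_min F10 lee01.
have G1F1' : G1 <= F1' + r1.
  rewrite /F1'; have [_|_] := leP F1 1; first exact: le_add_excess.
  by rewrite (le_trans G11)// leeDl.
apply: (@le_trans _ _ ((F1' + r1) * G2)); first by rewrite lee_wpmul2r.
rewrite ge0_muleDl// [r1 + r2]addeC addeA leeD//; last first.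
  by rewrite -[leRHS]mule1 lee_wpmul2l.
apply: (@le_trans _ _ (F1' * (F2 + r2))).
  by rewrite lee_wpmul2l// le_add_excess.
rewrite ge0_muleDr// leeD//.
  by rewrite lee_wpmul2r// ge_min lexx.
by rewrite -[leRHS]mul1e lee_wpmul2r// ge_min lexx orbT.
Qed.

(** Composing finite unbounded kernels can give infinite values, and truncation acts on such
    compositions, so kernels are extended-real here. On real kernels this is convertible with
    [compo]. *)
Definition ecompo {d1 d2 d3} {V1 : measurableType d1} {V2 : measurableType d2}
    {V3 : measurableType d3} (P2 : probability V2 R) (h : V1 -> V2 -> \bar R)
    (k : V2 -> V3 -> \bar R) : V1 -> V3 -> \bar R :=
  fun x1 x3 => \int[P2]_x2 (h x1 x2 * k x2 x3).

Lemma measurable_ecompo {d1 d2 d3} {V1 : measurableType d1}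
    {V2 : measurableType d2} {V3 : measurableType d3}
    (P2 : probability V2 R) (h : V1 -> V2 -> \bar R) (k : V2 -> V3 -> \bar R) :
  measurable_fun setT (fun p : V1 * V2 => h p.1 p.2) ->
  measurable_fun setT (fun p : V2 * V3 => k p.1 p.2) ->
  (forall x y, 0 <= h x y) -> (forall x y, 0 <= k x y) ->
  measurable_fun setT (fun p : V1 * V3 => ecompo P2 h k p.1 p.2).
Proof.
move=> mh mk h0 k0.
apply: (measurable_integral (F := fun (p : V1 * V3) x2 => h p.1 x2 * k x2 p.2)).
  by measurability.
by nonneg.
Qed.

Lemma ecompo_01 {d1 d2 d3} {V1 : measurableType d1}
    {V2 : measurableType d2} {V3 : measurableType d3}
    (P2 : probability V2 R) (h : V1 -> V2 -> \bar R) (k : V2 -> V3 -> \bar R) :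
  measurable_fun setT (fun p : V1 * V2 => h p.1 p.2) ->
  measurable_fun setT (fun p : V2 * V3 => k p.1 p.2) ->
  (forall x y, 0 <= h x y <= 1) -> (forall x y, 0 <= k x y <= 1) ->
  forall x1 x3, 0 <= ecompo P2 h k x1 x3 <= 1.
Proof.
move=> mh mk h01 k01 x1 x3; apply/andP; split; first by rewrite /ecompo; nonneg.
rewrite -[leRHS](integral_probability_cst P2 1); apply: le_integralT => //.
- by nonneg.
- move=> x2; have /andP[? ?] := h01 x1 x2; have /andP[? ?] := k01 x2 x3.
  by rewrite -[leRHS]mule1 lee_pmul.
- by measurability.
Qed.

(** Once [x2] is outermost, the two ends decouple: [h] and [a] involve only [x1], while [k] and [b]
    involve only [x3]. *)
Lemma weighted_ecompo {d1 d2 d3} {V1 : measurableType d1}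
    {V2 : measurableType d2} {V3 : measurableType d3} (P1 : probability V1 R)
    (P2 : probability V2 R) (P3 : probability V3 R) (h : V1 -> V2 -> \bar R)
    (k : V2 -> V3 -> \bar R) (a : V1 -> \bar R) (b : V3 -> \bar R) :
  measurable_fun setT (fun p : V1 * V2 => h p.1 p.2) ->
  measurable_fun setT (fun p : V2 * V3 => k p.1 p.2) ->
  measurable_fun setT a -> measurable_fun setT b ->
  (forall x y, 0 <= h x y) -> (forall x y, 0 <= k x y) ->
  (forall x, 0 <= a x) -> (forall x, 0 <= b x) ->
  \int[P1]_x1 \int[P3]_x3 (ecompo P2 h k x1 x3 * (a x1 * b x3)) =
  \int[P2]_x2 ((\int[P1]_x1 (h x1 x2 * a x1)) * \int[P3]_x3 (k x2 x3 * b x3)).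
Proof.
move=> mh mk ma mb h0 k0 a0 b0.
transitivity (\int[P1]_x1 \int[P2]_x2 \int[P3]_x3
    ((h x1 x2 * a x1) * (k x2 x3 * b x3))).
  apply: eq_integral => x1 _; rewrite integral_swap; last 2 first.
  - by measurability.
  - by nonneg.
  apply: eq_integral => x3 _; rewrite /ecompo -ge0_integralZr//.
  - by apply: eq_integral => x2 _; rewrite muleACA.
  - by measurability.
  - by nonneg.
  - by nonneg.
rewrite integral_swap; last 2 first.
- apply: (measurable_integral (F := fun (p : V1 * V2) x3 =>
    (h p.1 p.2 * a p.1) * (k p.2 x3 * b x3))); first by measurability.
  by nonneg.
- by nonneg.
apply: eq_integral => x2 _; rewrite -ge0_integralZr//; last first.
- by nonneg.
- by nonneg.
- by measurability.
apply: eq_integral => x1 _; rewrite ge0_integralZl//.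
- by measurability.
- by nonneg.
- by nonneg.
Qed.

(* Integrating out the two outer variables first leaves a product of two
   functions of the middle variable, each of which may be capped at 1. *)
Lemma cut_le_ecompo {d1 d2 d3} {V1 : measurableType d1}
    {V2 : measurableType d2} {V3 : measurableType d3} (P1 : probability V1 R)
    (P2 : probability V2 R) (P3 : probability V3 R)
    (g12 f12 : V1 -> V2 -> \bar R) (g23 f23 : V2 -> V3 -> \bar R)
    (delta12 delta23 : R) :
  measurable_fun setT (fun p : V1 * V2 => f12 p.1 p.2) ->
  measurable_fun setT (fun p : V1 * V2 => g12 p.1 p.2) ->
  measurable_fun setT (fun p : V2 * V3 => f23 p.1 p.2) ->
  measurable_fun setT (fun p : V2 * V3 => g23 p.1 p.2) ->
  (forall x y, 0 <= f12 x y) -> (forall x y, 0 <= g12 x y <= 1) ->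
  (forall x y, 0 <= f23 x y) -> (forall x y, 0 <= g23 x y <= 1) ->
  cut_le P1 P2 g12 f12 delta12 -> cut_le P2 P3 g23 f23 delta23 ->
  cut_le P1 P3 (ecompo P2 g12 g23) (ecompo P2 f12 f23) (delta12 + delta23).
Proof.
move=> mf12 mg12 mf23 mg23 f120 g1201 f230 g2301 c12 c23 a b ma mb a01 b01.
have g120 x y : 0 <= g12 x y by nonneg.
have g230 x y : 0 <= g23 x y by nonneg.
have a0 x : 0 <= a x by nonneg.
have b0 x : 0 <= b x by nonneg.
rewrite !(weighted_ecompo P1 P2 P3)//.
have mI d (T : measurableType d) (A : set T) : measurable A ->
    measurable_fun setT (fun x => (\1_A x)%:E : \bar R).
  by move=> mA; apply/measurable_EFinP; exact: measurable_indic.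
(* The excess must be a function of the shared variable [x2], which is the second argument of [g12]
   and [f12]; hence these kernels are read backwards. *)
have E1 : \int[P2]_x2 maxe (\int[P1]_x1 (g12 x1 x2 * a x1) -
    \int[P1]_x1 (f12 x1 x2 * a x1)) 0 <= delta12%:E.
  apply: (excess_le_of_indicators P2 P1 (fun y x => g12 x y)
    (fun y x => f12 x y)) => //.
  - by measurability.
  - by measurability.
  - move=> A mA.
    have A0 y : 0 <= (\1_A y : R)%:E by have /andP[] := indicator_01 A y.
    have mA1 := mI _ _ A mA.
    rewrite -(weighted_swap P1 P2 g12)// -(weighted_swap P1 P2 f12)//.
    by apply: c12 => //; exact: indicator_01.
have E2 : \int[P2]_x2 maxe (\int[P3]_x3 (g23 x2 x3 * b x3) -
    \int[P3]_x3 (f23 x2 x3 * b x3)) 0 <= delta23%:E.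
  apply: excess_le_of_indicators => // A mA.
  by apply: c23 => //; [exact: mI | exact: indicator_01].
have int01 d (T : measurableType d) (P : probability T R) (F G : T -> \bar R) :
    measurable_fun setT F -> measurable_fun setT G ->
    (forall x, 0 <= F x <= 1) -> (forall x, 0 <= G x <= 1) ->
    0 <= \int[P]_x (F x * G x) <= 1.
  move=> mF mG F01 G01; apply/andP; split; first by nonneg.
  rewrite -[leRHS](integral_probability_cst P 1); apply: le_integralT => //.
  - by nonneg.
  - move=> x; have /andP[? ?] := F01 x; have /andP[? ?] := G01 x.
    by rewrite -[leRHS]mule1 lee_pmul.
  - by measurability.
have m1 (h : V1 -> V2 -> \bar R) : (forall x y, 0 <= h x y) ->
    measurable_fun setT (fun p : V1 * V2 => h p.1 p.2) ->
    measurable_fun setT (fun x2 => \int[P1]_x1 (h x1 x2 * a x1)).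
  move=> h0 mh.
  by apply: (measurable_marginal P1 (fun y x => h x y)) => //; measurability.
have m3 (h : V2 -> V3 -> \bar R) : (forall x y, 0 <= h x y) ->
    measurable_fun setT (fun p : V2 * V3 => h p.1 p.2) ->
    measurable_fun setT (fun x2 => \int[P3]_x3 (h x2 x3 * b x3)).
  by move=> h0 mh; exact: measurable_marginal.
(* Replacing the two errors by the integrals of the excesses makes the claim pointwise in [x2],
   where it is [mule_le_add_excess]. *)
rewrite EFinD; apply: le_trans (leeD2l _ (leeD E1 E2)).
have mE (F G : V2 -> \bar R) : measurable_fun setT F -> measurable_fun setT G ->
    measurable_fun setT (fun x => maxe (G x - F x) 0).
  by move=> mF mG; apply: measurable_maxe => //; exact: emeasurable_funB.
have E0 (c : \bar R) : 0 <= maxe c 0 by rewrite le_max lexx orbT.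
rewrite -ge0_integralD//; try by [move=> *; exact: E0 | apply: mE; auto].
rewrite -ge0_integralD//; last first.
- by apply: emeasurable_funD; apply: mE; auto.
- by move=> x _; rewrite adde_ge0.
- by apply: emeasurable_funM; auto.
- by nonneg.
apply: le_integralT => //.
- by nonneg.
- move=> x2; apply: mule_le_add_excess.
  + by nonneg.
  + by nonneg.
  + by apply: int01 => //; measurability.
  + apply: int01 => //; exact: (measurable_uncurried (fun=> x2) id mg23).
- by apply: emeasurable_funM; auto.
- apply: emeasurable_funD; first by apply: emeasurable_funM; auto.
  by apply: emeasurable_funD; apply: mE; auto.
Qed.

(** * Truncation paid for by the second moment *)

(** Below [K] the first term suffices; above [K], the factor [t / K] exceeds 1, so the second
    does. *)
Lemma le_mine_add_square (t : \bar R) (K : R) : (0 < K)%R -> 0 <= t ->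
  t <= mine t K%:E + (K^-1)%:E * (t * t).
Proof.
move=> K0; case: t => [t t0|_|//]; last first.
  by rewrite mulyy gt0_muley ?lte_fin ?invr_gt0// addey// min_r ?leey.
have [_|Kt] := leP t%:E K%:E.
  by rewrite leeDl// mule_ge0 ?mule_ge0// lee_fin invr_ge0 ltW.
rewrite lte_fin in Kt.
apply: (@le_trans _ _ ((K^-1)%:E * (t%:E * t%:E))).
  rewrite -!EFinM lee_fin mulrA ler_peMl//.
  by rewrite ler_pdivlMl// mulr1 ltW.
by rewrite leeDr// lee_fin ltW.
Qed.

(** Integrate [le_mine_add_square] against the weights, keeping them on the truncated kernel and
    bounding them by 1 on the square: the mass cut off is at most [C / K]. *)
Lemma cut_le_truncate {d1 d2} {V : measurableType d1}
    {W : measurableType d2} (P : probability V R) (Q : probability W R)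
    (g f : V -> W -> \bar R) (K C delta : R) :
  (0 < K)%R -> measurable_fun setT (fun p : V * W => f p.1 p.2) ->
  (forall x y, 0 <= f x y) -> L2sq P Q f <= C%:E ->
  cut_le P Q g f delta ->
  cut_le P Q g (fun x y => mine (f x y) K%:E) (delta + K^-1 * C).
Proof.
move=> K0 mf f0 fC gf a b ma mb a01 b01.
have a0 x : 0 <= a x by nonneg.
have b0 x : 0 <= b x by nonneg.
have Ki0 : 0 <= (K^-1)%:E :> \bar R by rewrite lee_fin invr_ge0 ltW.
have mK : measurable_fun setT (fun p : V * W => mine (f p.1 p.2) K%:E).
  exact: measurable_mine.
have m0 x y : 0 <= mine (f x y) K%:E by rewrite le_min f0 lee_fin ltW.
apply: (le_trans (gf a b ma mb a01 b01)).
rewrite EFinD [delta%:E + _]addeC addeA leeD2r//.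
have fC' : \int[P]_x \int[Q]_y ((K^-1)%:E * (f x y * f x y)) <= (K^-1 * C)%:E.
  have mff : measurable_fun setT (fun p : V * W => f p.1 p.2 * f p.1 p.2).
    by measurability.
  rewrite EFinM; apply: le_trans (lee_wpmul2l Ki0 fC).
  rewrite /L2sq (integral_prod P Q (fun x y => f x y * f x y))//; last by nonneg.
  rewrite -ge0_integralZl//; last first.
  - by nonneg.
  - by apply: (measurable_integral (F := fun x y => f x y * f x y)) => //; nonneg.
  rewrite le_eqVlt; apply/orP; left; apply/eqP; apply: eq_integral => x _.
  rewrite ge0_integralZl//; last by nonneg.
  by measurability.
apply: le_trans (leeD2l _ fC').
have mw (h : V -> W -> \bar R) :
    measurable_fun setT (fun p : V * W => h p.1 p.2) ->
    measurable_fun setT (fun p : V * W => h p.1 p.2 * (a p.1 * b p.2)).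
  by move=> mh; exact: measurable_weighted.
rewrite -ge0_integralD//; last first.
- apply: (measurable_integral (F := fun x y => (K^-1)%:E * (f x y * f x y))).
    by measurability.
  by nonneg.
- by nonneg.
- apply: (measurable_integral (F := fun x y => mine (f x y) K%:E * (a x * b y))).
    exact: (mw (fun x y => mine (f x y) K%:E)).
  by nonneg.
- by nonneg.
have mi : measurable_fun setT (fun x =>
    \int[Q]_y (mine (f x y) K%:E * (a x * b y) + (K^-1)%:E * (f x y * f x y))).
  apply: (measurable_integral (F := fun x y =>
    mine (f x y) K%:E * (a x * b y) + (K^-1)%:E * (f x y * f x y))).
    apply: emeasurable_funD; first exact: (mw (fun x y => mine (f x y) K%:E)).
    by measurability.
  by nonneg.
have splitD x : \int[Q]_y (mine (f x y) K%:E * (a x * b y)) +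
    \int[Q]_y ((K^-1)%:E * (f x y * f x y)) =
    \int[Q]_y (mine (f x y) K%:E * (a x * b y) + (K^-1)%:E * (f x y * f x y)).
  rewrite ge0_integralD//.
  - by nonneg.
  - by measurability.
  - by nonneg.
  - by measurability.
under [leRHS]eq_integral do rewrite splitD.
apply: le_integralT => //.
- by nonneg.
- move=> x; apply: le_integralT.
  + by nonneg.
  + move=> y; apply: (@le_trans _ _
      ((mine (f x y) K%:E + (K^-1)%:E * (f x y * f x y)) * (a x * b y))).
      by rewrite lee_wpmul2r ?le_mine_add_square//; nonneg.
    rewrite ge0_muleDl//; [|by nonneg..].
    rewrite leeD2l// -[leRHS]mule1 lee_wpmul2l//; first by nonneg.
    rewrite -[leRHS]mule1 lee_pmul//.
      by have /andP[] := a01 x.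
    by have /andP[] := b01 y.
  + by measurability.
  + by measurability.
- apply: (measurable_integral (F := fun x y => f x y * (a x * b y))).
    exact: mw.
  by nonneg.
Qed.

(** * Triangle densities *)

(** The last kernel lives on [V3 * V1], so the three are in cyclic order and a rotation is again a
    triangle. Any edge can thus be brought to the middle, the place where [triangle_cut_le]
    exchanges it. *)
Definition triangle {d1 d2 d3} {V1 : measurableType d1}
    {V2 : measurableType d2} {V3 : measurableType d3} (P1 : probability V1 R)
    (P2 : probability V2 R) (P3 : probability V3 R) (u : V1 -> V2 -> \bar R)
    (v : V2 -> V3 -> \bar R) (w : V3 -> V1 -> \bar R) : \bar R :=
  \int[P1]_x1 \int[P2]_x2 \int[P3]_x3 (u x1 x2 * (v x2 x3 * w x3 x1)).

Lemma triangle_rot {d1 d2 d3} {V1 : measurableType d1}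
    {V2 : measurableType d2} {V3 : measurableType d3} (P1 : probability V1 R)
    (P2 : probability V2 R) (P3 : probability V3 R) (u : V1 -> V2 -> \bar R)
    (v : V2 -> V3 -> \bar R) (w : V3 -> V1 -> \bar R) :
  measurable_fun setT (fun p : V1 * V2 => u p.1 p.2) ->
  measurable_fun setT (fun p : V2 * V3 => v p.1 p.2) ->
  measurable_fun setT (fun p : V3 * V1 => w p.1 p.2) ->
  (forall x y, 0 <= u x y) -> (forall x y, 0 <= v x y) ->
  (forall x y, 0 <= w x y) ->
  triangle P1 P2 P3 u v w = triangle P2 P3 P1 v w u.
Proof.
move=> mu mv mw u0 v0 w0; rewrite /triangle integral_swap; last 2 first.
- apply: (measurable_integral (F := fun (p : V1 * V2) x3 =>
    u p.1 p.2 * (v p.2 x3 * w x3 p.1))); first by measurability.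
  by nonneg.
- by nonneg.
apply: eq_integral => x2 _; rewrite integral_swap; last 2 first.
- by measurability.
- by nonneg.
apply: eq_integral => x3 _; apply: eq_integral => x1 _.
by rewrite muleC muleA.
Qed.

Lemma le_triangle {d1 d2 d3} {V1 : measurableType d1}
    {V2 : measurableType d2} {V3 : measurableType d3} (P1 : probability V1 R)
    (P2 : probability V2 R) (P3 : probability V3 R) (u u' : V1 -> V2 -> \bar R)
    (v : V2 -> V3 -> \bar R) (w w' : V3 -> V1 -> \bar R) :
  measurable_fun setT (fun p : V1 * V2 => u p.1 p.2) ->
  measurable_fun setT (fun p : V1 * V2 => u' p.1 p.2) ->
  measurable_fun setT (fun p : V2 * V3 => v p.1 p.2) ->
  measurable_fun setT (fun p : V3 * V1 => w p.1 p.2) ->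
  measurable_fun setT (fun p : V3 * V1 => w' p.1 p.2) ->
  (forall x y, 0 <= u' x y) -> (forall x y, 0 <= v x y) ->
  (forall x y, 0 <= w' x y) ->
  (forall x y, u' x y <= u x y) -> (forall x y, w' x y <= w x y) ->
  triangle P1 P2 P3 u' v w' <= triangle P1 P2 P3 u v w.
Proof.
move=> mu mu' mv mw mw' u'0 v0 w'0 uu ww.
have u0 x y : 0 <= u x y by apply: le_trans (uu x y).
have w0 x y : 0 <= w x y by apply: le_trans (ww x y).
have mT (s : V1 -> V2 -> \bar R) (t : V3 -> V1 -> \bar R) :
    measurable_fun setT (fun p : V1 * V2 => s p.1 p.2) ->
    measurable_fun setT (fun p : V3 * V1 => t p.1 p.2) ->
    (forall x y, 0 <= s x y) -> (forall x y, 0 <= t x y) ->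
    measurable_fun setT (fun p : V1 * V2 =>
      \int[P3]_x3 (s p.1 p.2 * (v p.2 x3 * t x3 p.1))).
  move=> ms mt s0 t0.
  apply: (measurable_integral (F := fun (p : V1 * V2) x3 =>
    s p.1 p.2 * (v p.2 x3 * t x3 p.1))); first by measurability.
  by nonneg.
have mT2 := mT _ _ mu mw u0 w0; have mT2' := mT _ _ mu' mw' u'0 w'0.
apply: le_integralT.
- by nonneg.
- move=> x1; apply: le_integralT.
  + by nonneg.
  + move=> x2; apply: le_integralT.
    * by nonneg.
    * by move=> x3; rewrite lee_pmul ?lee_wpmul2l//; nonneg.
    * by measurability.
    * by measurability.
  + exact: (measurableT_comp mT2' (pair1_measurable x1)).
  + exact: (measurableT_comp mT2 (pair1_measurable x1)).
- apply: (measurable_integral (F := fun x1 x2 =>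
    \int[P3]_x3 (u' x1 x2 * (v x2 x3 * w' x3 x1)))) => //; by nonneg.
- apply: (measurable_integral (F := fun x1 x2 =>
    \int[P3]_x3 (u x1 x2 * (v x2 x3 * w x3 x1)))) => //; by nonneg.
Qed.

(** For fixed [x1] the outer kernels are functions of [x2] alone and of [x3] alone. Divided by [K]
    and [L] they are admissible weights for [cut_le]; undoing the scaling multiplies the error by
    [K L]. *)
Lemma triangle_cut_le {d1 d2 d3} {V1 : measurableType d1}
    {V2 : measurableType d2} {V3 : measurableType d3} (P1 : probability V1 R)
    (P2 : probability V2 R) (P3 : probability V3 R) (u : V1 -> V2 -> \bar R)
    (v v' : V2 -> V3 -> \bar R) (w : V3 -> V1 -> \bar R) (K L delta : R) :
  (0 < K)%R -> (0 < L)%R ->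
  measurable_fun setT (fun p : V1 * V2 => u p.1 p.2) ->
  measurable_fun setT (fun p : V2 * V3 => v p.1 p.2) ->
  measurable_fun setT (fun p : V2 * V3 => v' p.1 p.2) ->
  measurable_fun setT (fun p : V3 * V1 => w p.1 p.2) ->
  (forall x y, 0 <= u x y <= K%:E) -> (forall x y, 0 <= v x y) ->
  (forall x y, 0 <= v' x y) -> (forall x y, 0 <= w x y <= L%:E) ->
  (0 <= delta)%R -> cut_le P2 P3 v' v delta ->
  triangle P1 P2 P3 u v' w <= triangle P1 P2 P3 u v w + (K * L * delta)%:E.
Proof.
move=> K0 L0 mu mv mv' mw uK v0 v'0 wL delta0 vv'.
have u0 x y : 0 <= u x y by nonneg.
have w0 x y : 0 <= w x y by nonneg.
have KL0 : 0 <= (K * L)%:E by rewrite lee_fin mulr_ge0 ?ltW.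
have Ki0 : 0 <= (K^-1)%:E by rewrite lee_fin invr_ge0 ltW.
have Li0 : 0 <= (L^-1)%:E by rewrite lee_fin invr_ge0 ltW.
have normalize (s : V2 -> V3 -> \bar R) x1 :
    measurable_fun setT (fun p : V2 * V3 => s p.1 p.2) ->
    (forall x y, 0 <= s x y) ->
    \int[P2]_x2 \int[P3]_x3 (u x1 x2 * (s x2 x3 * w x3 x1)) =
    (K * L)%:E * \int[P2]_x2 \int[P3]_x3
      (s x2 x3 * ((u x1 x2 * (K^-1)%:E) * (w x3 x1 * (L^-1)%:E))).
  move=> ms s0; rewrite -ge0_integralZl//; last 2 first.
  - apply: (measurable_integral (F := fun x2 x3 =>
      s x2 x3 * ((u x1 x2 * (K^-1)%:E) * (w x3 x1 * (L^-1)%:E)))).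
      by measurability.
    by nonneg.
  - by nonneg.
  apply: eq_integral => x2 _; rewrite -ge0_integralZl//; last 2 first.
  - by measurability.
  - by nonneg.
  apply: eq_integral => x3 _.
  rewrite [(_ * (K^-1)%:E) * _]muleACA [RHS]muleCA.
  rewrite [X in _ = _ * X]muleCA.
  rewrite -!EFinM mulrACA !mulfV ?gt_eqF// mulr1 mule1.
  by rewrite muleCA.
have scaled_01 (k : R) (t : \bar R) : (0 < k)%R -> 0 <= t <= k%:E ->
    0 <= t * (k^-1)%:E <= 1.
  move=> k0 /andP[t0 tk].
  have ki0 : 0 <= (k^-1)%:E by rewrite lee_fin invr_ge0 ltW.
  rewrite mule_ge0//=.
  have -> : 1 = k%:E * (k^-1)%:E by rewrite -EFinM mulfV ?gt_eqF.
  exact: lee_wpmul2r.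
have mT (s : V2 -> V3 -> \bar R) :
    measurable_fun setT (fun p : V2 * V3 => s p.1 p.2) ->
    (forall x y, 0 <= s x y) ->
    measurable_fun setT (fun x1 =>
      \int[P2]_x2 \int[P3]_x3 (u x1 x2 * (s x2 x3 * w x3 x1))).
  move=> ms s0; apply: (measurable_integral (F := fun x1 x2 =>
    \int[P3]_x3 (u x1 x2 * (s x2 x3 * w x3 x1)))); last by nonneg.
  apply: (measurable_integral (F := fun (p : V1 * V2) x3 =>
    u p.1 p.2 * (s p.2 x3 * w x3 p.1))); last by nonneg.
  by measurability.
have KLd0 : 0 <= (K * L * delta)%:E by rewrite lee_fin !mulr_ge0// ltW.
(* The constant error is written as an average over [x1], so that the comparison can be made for
   each [x1] separately. *)
rewrite -[X in _ <= _ + X](integral_probability_cst P1) /triangle.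
rewrite -ge0_integralD//; last 2 first.
- by nonneg.
- exact: mT.
apply: le_integralT => //.
- by nonneg.
- move=> x1; rewrite !normalize// [(K * L * delta)%:E]EFinM.
  rewrite -ge0_muleDr//; last by nonneg.
  apply: lee_wpmul2l => //; apply: vv'.
  + by measurability.
  + by measurability.
  + by move=> x2; apply: scaled_01.
  + by move=> x3; apply: scaled_01.
- exact: mT.
- by apply: emeasurable_funD => //; exact: mT.
Qed.

(** * The 5-cycle as a triangle on [V1], [V3], [V4] *)

Lemma E5_triangle {d1 d2 d3 d4 d5} {V1 : measurableType d1}
    {V2 : measurableType d2} {V3 : measurableType d3} {V4 : measurableType d4}
    {V5 : measurableType d5} (P1 : probability V1 R) (P2 : probability V2 R)
    (P3 : probability V3 R) (P4 : probability V4 R) (P5 : probability V5 R)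
    (f12 : V1 -> V2 -> R) (f23 : V2 -> V3 -> R) (f34 : V3 -> V4 -> R)
    (f45 : V4 -> V5 -> R) (f51 : V5 -> V1 -> R) :
  measurable_fun setT (fun p : V1 * V2 => f12 p.1 p.2) ->
  measurable_fun setT (fun p : V2 * V3 => f23 p.1 p.2) ->
  measurable_fun setT (fun p : V3 * V4 => f34 p.1 p.2) ->
  measurable_fun setT (fun p : V4 * V5 => f45 p.1 p.2) ->
  measurable_fun setT (fun p : V5 * V1 => f51 p.1 p.2) ->
  (forall x y, (0 <= f12 x y)%R) -> (forall x y, (0 <= f23 x y)%R) ->
  (forall x y, (0 <= f34 x y)%R) -> (forall x y, (0 <= f45 x y)%R) ->
  (forall x y, (0 <= f51 x y)%R) ->
  E5 P1 P2 P3 P4 P5 (fun x1 x2 x3 x4 x5 =>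
      (f12 x1 x2 * f23 x2 x3 * f34 x3 x4 * f45 x4 x5 * f51 x5 x1)%R) =
  triangle P1 P3 P4
    (ecompo P2 (fun x y => (f12 x y)%:E) (fun x y => (f23 x y)%:E))
    (fun x y => (f34 x y)%:E)
    (ecompo P5 (fun x y => (f45 x y)%:E) (fun x y => (f51 x y)%:E)).
Proof.
move=> /measurable_EFinP m12 /measurable_EFinP m23 /measurable_EFinP m34.
move=> /measurable_EFinP m45 /measurable_EFinP m51 f12_0 f23_0 f34_0 f45_0 f51_0.
pose e12 x y := (f12 x y)%:E; pose e23 x y := (f23 x y)%:E.
pose e34 x y := (f34 x y)%:E; pose e45 x y := (f45 x y)%:E.
pose e51 x y := (f51 x y)%:E.
have e12_0 x y : 0 <= e12 x y by rewrite lee_fin.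
have e23_0 x y : 0 <= e23 x y by rewrite lee_fin.
have e34_0 x y : 0 <= e34 x y by rewrite lee_fin.
have e45_0 x y : 0 <= e45 x y by rewrite lee_fin.
have e51_0 x y : 0 <= e51 x y by rewrite lee_fin.
have {}m12 : measurable_fun setT (fun p : V1 * V2 => e12 p.1 p.2) by [].
have {}m23 : measurable_fun setT (fun p : V2 * V3 => e23 p.1 p.2) by [].
have {}m34 : measurable_fun setT (fun p : V3 * V4 => e34 p.1 p.2) by [].
have {}m45 : measurable_fun setT (fun p : V4 * V5 => e45 p.1 p.2) by [].
have {}m51 : measurable_fun setT (fun p : V5 * V1 => e51 p.1 p.2) by [].
rewrite -/e12 -/e23 -/e34 -/e45 -/e51.
pose w := ecompo P5 e45 e51.
have w0 x y : 0 <= w x y by rewrite /w /ecompo; nonneg.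
have mw : measurable_fun setT (fun p : V4 * V1 => w p.1 p.2).
  exact: measurable_ecompo.
(* [M] is the composition of [e34] and [w]. It is free of [x2], so after exchanging [x2] with [x3]
   it leaves the [x2]-integral, and [f12], [f23] compose. *)
pose M x3 x1 := \int[P4]_x4 (e34 x3 x4 * w x4 x1).
have M0 x y : 0 <= M x y by rewrite /M; nonneg.
have mM : measurable_fun setT (fun p : V3 * V1 => M p.1 p.2).
  exact: measurable_ecompo.
rewrite /E5 /triangle.
transitivity (\int[P1]_x1 \int[P2]_x2 \int[P3]_x3
    (e12 x1 x2 * e23 x2 x3 * M x3 x1)).
  apply: eq_integral => x1 _; apply: eq_integral => x2 _.
  apply: eq_integral => x3 _; rewrite -ge0_integralZl//; last 3 first.
  - by measurability.
  - by nonneg.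
  - by nonneg.
  apply: eq_integral => x4 _; rewrite /w /ecompo muleA.
  rewrite -ge0_integralZl//; last 3 first.
  - by measurability.
  - by nonneg.
  - by nonneg.
  by apply: eq_integral => x5 _; rewrite !EFinM muleA.
apply: eq_integral => x1 _; rewrite integral_swap; last 2 first.
- by measurability.
- by nonneg.
apply: eq_integral => x3 _; rewrite ge0_integralZr//; last 2 first.
- by measurability.
- by nonneg.
rewrite ge0_integralZl//.
- by measurability.
- by nonneg.
- by rewrite /ecompo; nonneg.
Qed.

End cycle_counting.

(* f12 = f_{1,2} : V1 -> V2 -> R, ..., f51 = f_{5,1} : V5 -> V1 -> R (indices mod 5) *)
Theorem theorem3p2 (R : realType) (eps C : R)
  (d1 d2 d3 d4 d5 : measure_display)
  (V1 : measurableType d1) (V2 : measurableType d2) (V3 : measurableType d3)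
  (V4 : measurableType d4) (V5 : measurableType d5)
  (P1 : probability V1 R) (P2 : probability V2 R) (P3 : probability V3 R)
  (P4 : probability V4 R) (P5 : probability V5 R)
  (f12 g12 : V1 -> V2 -> R) (f23 g23 : V2 -> V3 -> R) (f34 g34 : V3 -> V4 -> R)
  (f45 g45 : V4 -> V5 -> R) (f51 g51 : V5 -> V1 -> R) :
  (0 < eps < 1)%R -> (1 <= C)%R ->
  (* measurability *)
  measurable_fun setT (fun p : V1 * V2 => f12 p.1 p.2) ->
  measurable_fun setT (fun p : V2 * V3 => f23 p.1 p.2) ->
  measurable_fun setT (fun p : V3 * V4 => f34 p.1 p.2) ->
  measurable_fun setT (fun p : V4 * V5 => f45 p.1 p.2) ->
  measurable_fun setT (fun p : V5 * V1 => f51 p.1 p.2) ->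
  measurable_fun setT (fun p : V1 * V2 => g12 p.1 p.2) ->
  measurable_fun setT (fun p : V2 * V3 => g23 p.1 p.2) ->
  measurable_fun setT (fun p : V3 * V4 => g34 p.1 p.2) ->
  measurable_fun setT (fun p : V4 * V5 => g45 p.1 p.2) ->
  measurable_fun setT (fun p : V5 * V1 => g51 p.1 p.2) ->
  (* nonnegativity of f, and 0 <= g <= 1 *)
  (forall x y, (0 <= f12 x y)%R) -> (forall x y, (0 <= f23 x y)%R) ->
  (forall x y, (0 <= f34 x y)%R) -> (forall x y, (0 <= f45 x y)%R) ->
  (forall x y, (0 <= f51 x y)%R) ->
  (forall x y, (0 <= g12 x y <= 1)%R) -> (forall x y, (0 <= g23 x y <= 1)%R) ->
  (forall x y, (0 <= g34 x y <= 1)%R) -> (forall x y, (0 <= g45 x y <= 1)%R) ->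
  (forall x y, (0 <= g51 x y <= 1)%R) ->
  (* cut norm closeness *)
  (cutnorm P1 P2 (fun x y => (f12 x y - g12 x y)%R) <= (eps ^+ 4)%R%:E)%E ->
  (cutnorm P2 P3 (fun x y => (f23 x y - g23 x y)%R) <= (eps ^+ 4)%R%:E)%E ->
  (cutnorm P3 P4 (fun x y => (f34 x y - g34 x y)%R) <= (eps ^+ 4)%R%:E)%E ->
  (cutnorm P4 P5 (fun x y => (f45 x y - g45 x y)%R) <= (eps ^+ 4)%R%:E)%E ->
  (cutnorm P5 P1 (fun x y => (f51 x y - g51 x y)%R) <= (eps ^+ 4)%R%:E)%E ->
  (* ||f_{i-1,i} o f_{i,i+1}||_2^2 <= C for i = 1..5 *)
  (L2sq P5 P2 (compo P1 f51 f12) <= C%:E)%E ->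
  (L2sq P1 P3 (compo P2 f12 f23) <= C%:E)%E ->
  (L2sq P2 P4 (compo P3 f23 f34) <= C%:E)%E ->
  (L2sq P3 P5 (compo P4 f34 f45) <= C%:E)%E ->
  (L2sq P4 P1 (compo P5 f45 f51) <= C%:E)%E ->
  (E5 P1 P2 P3 P4 P5 (fun x1 x2 x3 x4 x5 =>
      (f12 x1 x2 * f23 x2 x3 * f34 x3 x4 * f45 x4 x5 * f51 x5 x1)%R)
   >= E5 P1 P2 P3 P4 P5 (fun x1 x2 x3 x4 x5 =>
      (g12 x1 x2 * g23 x2 x3 * g34 x3 x4 * g45 x4 x5 * g51 x5 x1)%R)
      - (11 * C * eps)%R%:E)%E.
Proof.
move=> /andP[e0 e1] C1 mf12 mf23 mf34 mf45 mf51 mg12 mg23 mg34 mg45 mg51.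
move=> f12_0 f23_0 f34_0 f45_0 f51_0 g12_01 g23_01 g34_01 g45_01 g51_01.
move=> c12 c23 c34 c45 c51 _ L2u _ _ L2w.
have g0 (V W : Type) (g : V -> W -> R) :
    (forall x y, (0 <= g x y <= 1)%R) -> forall x y, (0 <= g x y)%R.
  by move=> g01 x y; have /andP[] := g01 x y.
have eg01 (V W : Type) (g : V -> W -> R) :
    (forall x y, (0 <= g x y <= 1)%R) -> forall x y, (0 <= (g x y)%:E <= 1)%E.
  by move=> g01 x y; rewrite !lee_fin.
have ef0 (V W : Type) (f : V -> W -> R) :
    (forall x y, (0 <= f x y)%R) -> forall x y, (0 <= (f x y)%:E)%E.
  by move=> f0 x y; rewrite lee_fin.
have me d d' (V : measurableType d) (W : measurableType d') (f : V -> W -> R) :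
    measurable_fun setT (fun p : V * W => f p.1 p.2) ->
    measurable_fun setT (fun p : V * W => (f p.1 p.2)%:E).
  by move=> mf; exact/measurable_EFinP.
have compoE d d' d'' (V : measurableType d) (W : measurableType d')
    (Z : measurableType d'') (P : probability W R) (h : V -> W -> R)
    (k : W -> Z -> R) : compo P h k =
    ecompo P (fun x y => (h x y)%:E) (fun x y => (k x y)%:E) by [].
rewrite compoE in L2u; rewrite compoE in L2w.
rewrite leeBlDr// !E5_triangle//; try exact: g0.
have {}c12 := cutnorm_cut_le _ _ _ _ _ mf12 mg12 f12_0 g12_01 c12.
have {}c23 := cutnorm_cut_le _ _ _ _ _ mf23 mg23 f23_0 g23_01 c23.
have {}c34 := cutnorm_cut_le _ _ _ _ _ mf34 mg34 f34_0 g34_01 c34.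
have {}c45 := cutnorm_cut_le _ _ _ _ _ mf45 mg45 f45_0 g45_01 c45.
have {}c51 := cutnorm_cut_le _ _ _ _ _ mf51 mg51 f51_0 g51_01 c51.
have cu := cut_le_ecompo _ _ _ _ _ _ _ _ _
  (me _ _ _ _ _ mf12) (me _ _ _ _ _ mg12)
  (me _ _ _ _ _ mf23) (me _ _ _ _ _ mg23) (ef0 _ _ _ f12_0)
  (eg01 _ _ _ g12_01) (ef0 _ _ _ f23_0) (eg01 _ _ _ g23_01) c12 c23.
have cw := cut_le_ecompo _ _ _ _ _ _ _ _ _
  (me _ _ _ _ _ mf45) (me _ _ _ _ _ mg45)
  (me _ _ _ _ _ mf51) (me _ _ _ _ _ mg51) (ef0 _ _ _ f45_0)
  (eg01 _ _ _ g45_01) (ef0 _ _ _ f51_0) (eg01 _ _ _ g51_01) c45 c51.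
move: L2u L2w cu cw.
set u := ecompo P2 (fun x y => (f12 x y)%:E) _.
set w := ecompo P5 (fun x y => (f45 x y)%:E) _.
set ug := ecompo P2 _ _; set wg := ecompo P5 _ _ => L2u L2w cu cw.
have mu : measurable_fun setT (fun p : V1 * V3 => u p.1 p.2).
  by apply: measurable_ecompo; [exact: me|exact: me|exact: ef0|exact: ef0].
have mw : measurable_fun setT (fun p : V4 * V1 => w p.1 p.2).
  by apply: measurable_ecompo; [exact: me|exact: me|exact: ef0|exact: ef0].
have mug : measurable_fun setT (fun p : V1 * V3 => ug p.1 p.2).
  by apply: measurable_ecompo; [exact: me|exact: me|apply: ef0; exact: g0..].
have mwg : measurable_fun setT (fun p : V4 * V1 => wg p.1 p.2).
  by apply: measurable_ecompo; [exact: me|exact: me|apply: ef0; exact: g0..].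
have u0 x y : (0 <= u x y)%E.
  by apply: integral_ge0 => z _; rewrite mule_ge0 ?lee_fin.
have w0 x y : (0 <= w x y)%E.
  by apply: integral_ge0 => z _; rewrite mule_ge0 ?lee_fin.
have ug01 x y : (0 <= ug x y <= 1)%E.
  by apply: ecompo_01; [exact: me|exact: me|exact: eg01|exact: eg01].
have wg01 x y : (0 <= wg x y <= 1)%E.
  by apply: ecompo_01; [exact: me|exact: me|exact: eg01|exact: eg01].
pose K := (eps ^- 2)%R; pose L := (eps^-1)%R.
have K0 : (0 < K)%R by rewrite invr_gt0 exprn_gt0.
have L0 : (0 < L)%R by rewrite invr_gt0.
have {}cu := cut_le_truncate _ _ _ _ _ _ _ K0 mu u0 L2u cu.
have {}cw := cut_le_truncate _ _ _ _ _ _ _ L0 mw w0 L2w cw.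
pose u' x y := mine (u x y) K%:E; pose w' x y := mine (w x y) L%:E.
rewrite -/u' -/w' in cu cw.
have mu' : measurable_fun setT (fun p : V1 * V3 => u' p.1 p.2).
  exact: measurable_mine.
have mw' : measurable_fun setT (fun p : V4 * V1 => w' p.1 p.2).
  exact: measurable_mine.
have u'K x y : (0 <= u' x y <= K%:E)%E.
  by rewrite le_min u0 lee_fin (ltW K0) ge_min lexx orbT.
have w'L x y : (0 <= w' x y <= L%:E)%E.
  by rewrite le_min w0 lee_fin (ltW L0) ge_min lexx orbT.
have mg := me _ _ _ _ _ mg34; have mf := me _ _ _ _ _ mf34.
have g01 := eg01 _ _ _ g34_01; have f0 := ef0 _ _ _ f34_0.
have ge0 (V W : Type) (M : \bar R) (f : V -> W -> \bar R) :
    (forall x y, (0 <= f x y <= M)%E) -> forall x y, (0 <= f x y)%E.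
  by move=> f01 x y; have /andP[] := f01 x y.
have e4 : (0 <= eps ^+ 4)%R by rewrite exprn_ge0 ?ltW.
have C0 : (0 <= C)%R by exact: le_trans C1.
have Ki0 : (0 <= K^-1)%R by rewrite invr_ge0; exact: ltW.
have Li0 : (0 <= L^-1)%R by rewrite invr_ge0; exact: ltW.
have du : (0 <= eps ^+ 4 + eps ^+ 4 + K^-1 * C)%R.
  by rewrite !addr_ge0// mulr_ge0.
have dw : (0 <= eps ^+ 4 + eps ^+ 4 + L^-1 * C)%R.
  by rewrite !addr_ge0// mulr_ge0.
(* The chain starts from the [g] side, so the exchanges appear in reverse: [wg] by [w'] against
   bounds 1 and 1, then [ug] by [u'] against [L] and 1, then [g34] by [f34] against [K] and [L]. *)
have step1 := triangle_cut_le P3 P4 P1 _ _ _ _ 1 1 _ ltr01 ltr01 mg mw' mwg mug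
  g01 (ge0 _ _ _ _ w'L) (ge0 _ _ _ _ wg01) ug01 dw cw.
have step2 := triangle_cut_le P4 P1 P3 _ _ _ _ L 1 _ L0 ltr01 mw' mu' mug mg
  w'L (ge0 _ _ _ _ u'K) (ge0 _ _ _ _ ug01) g01 du cu.
have step3 := triangle_cut_le P1 P3 P4 _ _ _ _ _ _ _ K0 L0 mu' mf mg mw' u'K f0
  (ge0 _ _ _ _ g01) w'L e4 c34.
(* Truncation only lowers nonnegative kernels, so removing it costs nothing in this direction. *)
have step4 : (triangle P1 P3 P4 u' (fun x y => (f34 x y)%:E) w' <=
    triangle P1 P3 P4 u (fun x y => (f34 x y)%:E) w)%E.
  apply: le_triangle => //;
    [exact: (ge0 _ _ _ _ u'K)|exact: (ge0 _ _ _ _ w'L)| |];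
    by move=> x y; rewrite ge_min lexx.
(* Each of the three rotations brings the next edge to the middle; together they restore the order
   [P1 P3 P4]. *)
rewrite triangle_rot//; [|exact: (ge0 _ _ _ _ ug01)
  |exact: (ge0 _ _ _ _ g01)
  |exact: (ge0 _ _ _ _ wg01)].
apply: (le_trans step1).
rewrite triangle_rot//; [|exact: (ge0 _ _ _ _ g01)
  |exact: (ge0 _ _ _ _ w'L)
  |exact: (ge0 _ _ _ _ ug01)].
apply: (le_trans (leeD2r _ step2)).
rewrite triangle_rot//; [|exact: (ge0 _ _ _ _ w'L)
  |exact: (ge0 _ _ _ _ u'K)
  |exact: (ge0 _ _ _ _ g01)].
apply: (le_trans (leeD2r _ (leeD2r _ step3))).
apply: (le_trans (leeD2r _ (leeD2r _ (leeD2r _ step4)))).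
move: (triangle P1 P3 P4 u _ w) => T.
rewrite -!addeA leeD2l// -!EFinD lee_fin /K /L !invrK.
have -> : (eps ^- 2 * eps^-1 * eps ^+ 4 = eps)%R.
  rewrite -exprVn -exprSr exprVn [(eps ^+ 4)%R]exprS mulrCA.
  by rewrite mulVf ?mulr1// expf_neq0// gt_eqF.
have -> : (eps^-1 * 1 * (eps ^+ 4 + eps ^+ 4 + eps ^+ 2 * C) =
    eps ^+ 3 + eps ^+ 3 + eps * C)%R by field; rewrite gt_eqF.
(* What remains is [2 eps^4 + 2 eps^3 + eps + 2 C eps]. As [eps < 1 <= C], each positive power of
   [eps] is at most [C eps], which gives the total of 7. *)
have e_le n : (0 < n)%N -> (eps ^+ n <= C * eps)%R.
  case: n => // n _; rewrite exprSr ler_wpM2r ?(ltW e0)//.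
  by rewrite (le_trans _ C1)// exprn_ile1// ltW.
have := e_le 4%N isT; have := e_le 3%N isT; have := e_le 1%N isT.
rewrite expr1; lra.
Qed.
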